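(* For any property $R\in\{\text{open},\ \text{closed},\ G_\delta,\ F_\sigma,\ \text{Borel}\}$ of subsets of a topological space, the following holds: there exists a metrizable space $X$ possessing a free $\omega_1$-complete $R$ ultrafilter if and only if there exists a measurable cardinal.
   Context: All topological spaces are assumed to be Hausdorff and infinite. Filters are proper. Let $R$ be a property of subsets of a topological space $X$. A filter $\mathcal F$ on $X$ is an $R$ filter if $\mathcal F$ possesses a base consisting of sets with property $R$. It is an $R$ ultrafilter if it is an $R$ filter and for any subset $A\subseteq X$ with property $R$ either $A\in\mathcal F$ or there is an element of $\mathcal F$ disjoint from $A$, i.e. $X\setminus A\in\mathcal F$. It is free if every $x\in X$ possesses an open neighborhood $U$ such that $X\setminus U\in\mathcal F$. For a cardinal $\kappa$, a filter $\mathcal F$ is $\kappa$-complete if for any $\lambda\in\kappa$ and any subfamily $\{F_\alpha:\alpha\in\lambda\}\subset\mathcal F$ the set $\bigcap_{\alpha\in\lambda}F_\alpha$ belongs to $\mathcal F$. An uncountable cardinal $\kappa$ is measurable if it possesses a nonprincipal $\kappa$-complete ultrafilter. *)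

(* Defs.v *)
From mathcomp Require Import all_boot all_order all_algebra.
From mathcomp Require Import all_classical all_reals all_analysis.
From mathcomp Require Import borel_hierarchy.

Set Implicit Arguments.
Unset Strict Implicit.
Unset Printing Implicit Defensive.

Import Order.TTheory GRing.Theory Num.Theory.

Local Open Scope classical_set_scope.
Local Open Scope ring_scope.
Local Open Scope card_scope.

Record is_metric (R : realType) (T : Type) (d : T -> T -> R) : Prop := IsMetric {
  metric_eq0 : forall x y, d x y = 0 <-> x = y ;
  metric_symm : forall x y, d x y = d y x ;
  metric_tri : forall x y z, d x z <= d x y + d y z }.

Definition metrizable (R : realType) (X : topologicalType) : Prop :=
  exists2 d : X -> X -> R, is_metric d &
    forall A : set X, open A <->
      (forall x, A x -> exists2 e : R, 0 < e & [set y | d x y < e] `<=` A).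

Inductive set_class := Open | Closed | GDelta | FSigma | Borel.

Definition sets_of (c : set_class) (X : topologicalType) : set_system X :=
  match c with
  | Open => open
  | Closed => closed
  | GDelta => Gdelta
  | FSigma => Fsigma
  | Borel => <<s open >>
  end.
Arguments sets_of : clear implicits.

Section Filters.
Variable T : Type.
Implicit Types (P F : set_system T).

Definition is_filter_of P F : Prop :=
  ProperFilter F /\
  exists2 B : set_system T, B `<=` P & F = filter_from B id.

Definition is_ultrafilter_of P F : Prop :=
  is_filter_of P F /\ forall A : set T, P A -> F A \/ F (~` A).

(* The cardinal kappa is represented by a type K of that cardinality, and the
   ordinals lambda < kappa by the subsets of K of cardinality less than K. *)
Definition complete_filter (K : Type) F : Prop :=
  forall (D : set K) (G : K -> set T), ~~ ([set: K] #<= D) ->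
    (forall i, D i -> F (G i)) -> F (\bigcap_(i in D) G i).

(* The ordinals lambda < omega_1 are the countable ones, represented by the
   subsets of nat. *)
Definition omega1_complete F : Prop :=
  forall (D : set nat) (G : nat -> set T),
    (forall i, D i -> F (G i)) -> F (\bigcap_(i in D) G i).

Definition principal F : Prop := exists A : set T, F = globally A.

End Filters.

Definition free_filter (X : topologicalType) (F : set_system X) : Prop :=
  forall x : X, exists2 U : set X, open_nbhs x U & F (~` U).

Definition measurable_cardinal (K : Type) : Prop :=
  ~~ countable [set: K] /\
  exists F : set_system K,
    [/\ UltraFilter F, ~ principal F & complete_filter K F].

(* Main.v *)
(* Every one of the five properties forces an [R] ultrafilter to decide all open
   sets. Stone's theorem yields a sigma-disjoint open refinement of a cover
   witnessing freeness; by omega_1-completeness the union of one of its disjoint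
   families belongs to the filter. Unions of subfamilies are open, hence decided,
   so the filter induces a nonprincipal omega_1-complete ultrafilter on the index
   set, and the least cardinality of a partition of this set into null pieces is
   measurable. Conversely, a measurable cardinal is taken with the discrete
   topology. *)
Require Import Defs.
From mathcomp Require Import all_boot all_order all_algebra.
From mathcomp Require Import all_classical all_reals all_analysis.
From mathcomp Require Import borel_hierarchy wochoice.

Local Open Scope classical_set_scope.

Import Order.TTheory GRing.Theory Num.Theory.

Local Open Scope card_scope.

(** * Comparison of cardinalities and well-orders *)

(* Zorn's lemma gives a maximal set of choice functions on [P] that are
   injective in each coordinate; by maximality, its values exhaust some [A] in
   [P], which then injects into every other member. *)
Lemma card_minimum {T : Type} {P : set (set T)} : P !=set0 ->
  exists2 A, P A & forall B, P B -> A #<= B.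
Proof.
move=> [A0 PA0].
have [[A PA A_empty]|nonempty] :=
    pselect (exists2 A, P A & ~ (A !=set0)).
  exists A => // B _; suff -> : A = set0 by exact: card_ge0.
  by apply/seteqP; split => // x Ax; apply: A_empty; exists x.
have [a0 _] : A0 !=set0 by apply: contrapT => A0_empty; apply: nonempty; exists A0.
pose partial_inj (S : set (set T -> T)) := forall A, P A ->
  (forall f, S f -> A (f A)) /\
  (forall f g, S f -> S g -> f A = g A -> f = g).
have [C chainP C_total|S [SP Smax]] := @Zorn_bigcup _ partial_inj.
  move=> A PA; split=> [f [S CS Sf]|f g [S CS Sf] [S' CS' S'g]].
    by have [+ _] := chainP _ CS _ PA; apply.
  have [SS'|S'S] := C_total _ _ CS CS'.
    by have [_ +] := chainP _ CS' _ PA; apply => //; exact: SS'.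
  by have [_ +] := chainP _ CS _ PA; apply => //; exact: S'S.
have [[A PA AS]|no_onto] :=
    pselect (exists2 A, P A & A `<=` [set f A | f in S]).
  exists A => // B PB; have [SB Sinj] := SP B PB.
  apply: (card_le_trans (subset_card_le AS)).
  apply: (card_le_trans (card_image_le _ _)).
  have /card_esym/card_eqPle[+ _] :
      [set f B | f in S] #= S.
    by apply: inj_card_eq => f g /set_mem Sf /set_mem Sg; exact: Sinj.
  move/card_le_trans; apply; apply: subset_card_le => _ [f Sf <-].
  exact: SB.
(* If [S] exhausts no member of [P], a choice function avoiding all its values contradicts
   maximality; [a0] fills the coordinates outside [P]. *)
have missing A : exists a, P A -> A a /\ forall f, S f -> f A <> a.
  have [PA|nPA] := pselect (P A); last by exists a0.
  apply: contrapT => no_a; apply: no_onto; exists A => // a Aa.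
  apply: contrapT => aS; apply: no_a; exists a => _; split => // f Sf fAa.
  by apply: aS; exists f.
have [g gP] := choice missing.
suff : partial_inj (S `|` [set g]).
  move=> /(Smax _ _)[]; split=> [f Sf|]; first by left.
  move=> /(_ g (or_intror erefl)) Sg.
  by have [_ /(_ _ Sg)] := gP _ PA0.
move=> A PA; have [SA Sinj] := SP A PA; have [gA gS] := gP A PA.
split=> [f [/SA//|->//]|f h [Sf|->] [Sh|->] //]; first exact: Sinj.
  by move=> /(gS _ Sf).
by move=> /esym /(gS _ Sh).
Qed.

(** Antisymmetry comes from the uniqueness of the least element of the pair [x], [y]. *)
Lemma exists_well_order (T : Type) : exists le : T -> T -> Prop,
  (forall x y, le x y -> le y x -> x = y) /\
  forall A : set T, A !=set0 -> exists2 x, A x & forall y, A y -> le x y.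
Proof.
have [le le_wo] := well_ordering_principle {classic T}.
have le_min (A : set T) : A !=set0 ->
    exists2 x, A x & forall y, A y -> le x y.
  move=> [x0 Ax0]; have [|x [[/asboolP Ax xmin] _]] :=
    le_wo (fun x => `[< A x >]); first by exists x0; exact/asboolP.
  by exists x => // y Ay; apply: xmin; exact/asboolP.
exists le; split=> [x y lexy leyx|]; last exact: le_min.
have le_refl z : le z z.
  by have [|_ -> zmin] := le_min [set z]; [exists z|exact: zmin].
have [|z [_ zuniq]] := le_wo (fun z => `[< z = x \/ z = y >]).
  by exists x; apply/asboolP; left.
transitivity z; [apply/esym|]; apply: zuniq; split.
- by apply/asboolP; left.
- by move=> w /asboolP[->|->].
- by apply/asboolP; right.
- by move=> w /asboolP[->|->].
Qed.

Lemma ultra_of_decides {T : Type} {F : set_system T} : ProperFilter F ->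
  (forall A, F A \/ F (~` A)) -> UltraFilter F.
Proof.
move=> F_proper F_decides; split => // G G_proper FG.
apply/seteqP; split => // A GA; have [//|/FG GnA] := F_decides A.
have G0 : G set0 by rewrite -(setICr A); exact: filterI.
by have := filter_not_empty G G0.
Qed.

Lemma ultra_principalP {T : Type} (F : set_system T) : UltraFilter F ->
  principal F <-> exists x, F [set x].
Proof.
move=> F_ultra; split=> [[A FA]|[x Fx]].
  have [A_empty|/set0P[x Ax]] := eqVneq A set0.
    by case: (filter_not_empty F); rewrite FA A_empty.
  exists x; have [//|] := in_ultra_setVsetC [set x] F_ultra.
  by rewrite FA => /(_ x Ax) /(_ erefl).
exists [set x]; apply/seteqP; split => B.
  by move=> FB _ ->; have [y [-> ]] := filter_ex (filterI Fx FB).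
by move=> xB; apply: filterS Fx.
Qed.

(** * Measurable cardinals from omega_1-complete ultrafilters *)

Section measurable_cardinal_existence.
Variables (I : Type) (F : set_system I).
Hypotheses (F_ultra : UltraFilter F) (F_free : ~ principal F).
Hypothesis F_omega1 : omega1_complete F.

(** Such an [f] is a partition of [I] into null pieces, possibly empty, indexed by [A]. *)
Let null_fibers_onto (A : set I) :=
  exists f : I -> I, (forall i, A (f i)) /\ forall a, ~ F (f @^-1` [set a]).

(* A map with null fibers whose range has least cardinality: completeness of
   the image filter holds because a failure would yield a map with smaller
   range. *)
Lemma exists_measurable_cardinal : exists K : Type, measurable_cardinal K.
Proof.
have [|A [f [fA f_null]] A_min] := @card_minimum _ null_fibers_onto.
  exists setT, id; split => // a Fa; apply: F_free; apply/ultra_principalP.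
  by exists a.
pose q i : A := SigSub (mem_set (fA i)).
have q_null (k : A) : ~ F (q @^-1` [set k]).
  apply: contra_not (f_null (val k)); apply: filterS => i /= qi.
  by rewrite -qi.
pose G : set_system A := [set S | F (q @^-1` S)].
have G_proper : ProperFilter G.
  split; first exact: filter_not_empty.
  split; first exact: filterT.
    by move=> S S'; exact: filterI.
  by move=> S S' SS'; apply: filterS => i; exact: SS'.
have G_ultra : UltraFilter G.
  by apply: ultra_of_decides => // S; exact: (in_ultra_setVsetC (q @^-1` S)).
exists A; split.
  (* Otherwise the complements of the fibers of [h \o q] are countably many members of [F] with
     empty intersection. *)
  apply/negP => /countable_injP[h h_inj].
  have /(F_omega1 setT) : forall n, setT n -> F (~` ((h \o q) @^-1` [set n])).
    move=> n _; have [|//] := in_ultra_setVsetC ((h \o q) @^-1` [set n]) F_ultra.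
    move=> Fn; have [i hi] := filter_ex Fn.
    case: (q_null (q i)); apply: filterS Fn => j /= hj.
    by apply: h_inj; rewrite ?in_setT //; rewrite hj -hi.
  by move=> /filter_ex[i /(_ (h (q i)) Logic.I)]; exact.
exists G; split => //.
  by move=> /ultra_principalP[k]; exact: q_null.
move=> D N D_small GN; apply: contrapT => not_GN.
have [[d0 Dd0]|D_empty] := pselect (D !=set0); last first.
  apply: not_GN; apply: filterS filterT => k _ d Dd.
  by case: D_empty; exists d.
(* The new map sends [i] to an index whose set misses [q i], or to the default [d0] if [q i] lies in
   the whole intersection. *)
have smaller i : exists d : A, D d /\
    ((~ exists2 d, D d & ~ N d (q i)) /\ d = d0 \/ ~ N d (q i)).
  have [[d Dd Ndi]|no_d] := pselect (exists2 d, D d & ~ N d (q i)).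
    by exists d; split=> //; right.
  by exists d0; split=> //; left.
have [g gP] := choice smaller.
suff : null_fibers_onto (val @` D).
  move=> /A_min /card_le_trans /(_ (card_image_le _ _)).
  by rewrite -(card_le_eql (card_setT A)) (negbTE D_small).
exists (val \o g); split=> [i|a Fa].
  by exists (g i) => //; have [] := gP i.
(* On a fiber in [F] cut with the preimage of [N (g i)], only the default case survives, which puts
   the intersection in [G]. *)
apply: not_GN.
have [i gi] := filter_ex Fa.
have Dgi : D (g i) by have [] := gP i.
have FN : F (q @^-1` N (g i)) := GN _ Dgi.
rewrite /G /=; apply: filterS (filterI Fa FN) => j [/= gj Nj] d Dd.
have gij : g j = g i by apply: val_inj; rewrite /= gj -gi.
have [_ [[no_d _]|]] := gP j; last by rewrite gij.
by apply: contrapT => Nd; apply: no_d; exists d.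
Qed.

End measurable_cardinal_existence.

(** * Stone's refinement and ultrafilters on metric spaces *)

Section metric.
Context {R : realType} {X : topologicalType} {d : X -> X -> R}.
Hypothesis d_metric : is_metric d.
Hypothesis d_open : forall A : set X, open A <->
  (forall x, A x -> exists2 e : R, (0 < e)%R & [set y | (d x y < e)%R] `<=` A).

Lemma metric_ball_open x e : open [set y | (d x y < e)%R].
Proof.
apply/d_open => y /= dxy; exists (e - d x y)%R; first by rewrite subr_gt0.
move=> z /= dyz; apply: le_lt_trans (metric_tri d_metric x y z) _.
by rewrite -ltrBrDl.
Qed.

(* Stone's construction: the points whose first cover member contains their
   ball of radius 1/n are separated by 1/n when these members differ. *)
Lemma metric_sigma_disjoint_refinement (I : Type) (U : I -> set X) :
  (forall i, open (U i)) -> (forall x, exists i, U i x) ->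
  exists E : nat -> I -> set X,
    [/\ forall n i, open (E n i),
        forall n i, E n i `<=` U i,
        forall n i j x, E n i x -> E n j x -> i = j &
        forall x, exists n i, E n i x].
Proof.
move=> U_open U_cover.
have [le [le_anti le_min]] := exists_well_order I.
have first_index x : exists i, U i x /\ forall j, U j x -> le i j.
  by have [i] := le_min [set i | U i x] (U_cover x); exists i.
have [r rP] := choice first_index.
pose e n : R := (n.+1%:R^-1)%R.
pose core n := [set x | [set y | (d x y < e n)%R] `<=` U (r x)].
have e_gt0 n : (0 < e n)%R by rewrite invr_gt0.
have d0 x : d x x = 0%R by apply/(metric_eq0 d_metric).
have core_sep n x y : core n x -> core n y -> (d x y < e n)%R -> r x = r y.
  (* Each point lies in the other's ball, hence in the other's first cover member. *)
  move=> xn yn dxy; apply: le_anti.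
    by apply: (rP x).2; apply: yn; rewrite /= (metric_symm d_metric).
  by apply: (rP y).2; apply: xn.
(* With half the radius, balls sharing a point have centers less than [e n] apart. *)
pose E n i := \bigcup_(x in [set x | core n x /\ r x = i])
  [set y | (d x y < e n / 2)%R].
exists E; split=> [n i|n i y [x [xn <-] /= dxy]|n i j z|x].
- by apply: bigcup_open => x _; exact: metric_ball_open.
- apply: xn => /=; apply: lt_le_trans dxy _.
  by rewrite ler_pdivrMr // ler_peMr ?ler1n // ltW.
- move=> [x [xn <-] /= dxz] [y [yn <-] /= dyz]; apply: (core_sep _ _ _ xn yn).
  apply: le_lt_trans (metric_tri d_metric x z y) _.
  by rewrite (metric_symm d_metric z y) [e n]splitr ltrD.
have /d_open/(_ x (rP x).1)[eps eps_gt0 epsU] := U_open (r x).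
have [n] := ltr_add_invr eps_gt0; rewrite add0r => n_eps.
exists n, (r x), x; last by rewrite /= d0 divr_gt0.
by split=> // y /= dxy; apply: epsU; exact: lt_trans dxy n_eps.
Qed.

Lemma metric_measurable_cardinal (F : set_system X) : ProperFilter F ->
  (forall A, open A -> F A \/ F (~` A)) -> free_filter F ->
  omega1_complete F -> exists K : Type, measurable_cardinal K.
Proof.
move=> F_proper F_decides F_free F_omega1.
have /choice[U UP] x : exists U : set X, open_nbhs x U /\ F (~` U).
  by have [U] := F_free x; exists U.
have [|x|E [E_open EU E_disj E_cover]] :=
  metric_sigma_disjoint_refinement X U.
- by move=> x; have [[]] := UP x.
- by exists x; have [[]] := UP x.
have [n Fn] : exists n, F (\bigcup_i E n i).
  apply: contrapT => no_n.
  have /(F_omega1 setT)/filter_ex[x] :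
      forall n, setT n -> F (~` \bigcup_i E n i).
    move=> n _; have [|Fn|//] := F_decides (\bigcup_i E n i).
      by apply: bigcup_open => i _.
    by case: no_n; exists n.
  by have [n [i Ex]] := E_cover x => /(_ n Logic.I); apply; exists i.
(* The cover is indexed by the points of [X], so the induced ultrafilter lives on the set [X]
   itself. *)
pose G : set_system X := [set S | F (\bigcup_(i in S) E n i)].
have GI (D : set nat) (S : nat -> set X) : (forall k, D k -> G (S k)) ->
    G (\bigcap_(k in D) S k).
  (* By disjointness a point has only one index, which therefore lies in every [S k]. *)
  move=> GS; apply: filterS (filterI Fn (F_omega1 D _ GS)) => x.
  move=> [[i _ Ei] ES]; exists i => // k Dk.
  by have [j Sj Ej] := ES k Dk; rewrite (E_disj _ _ _ _ Ei Ej).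
have G_proper : ProperFilter G.
  split; first by rewrite /G /= bigcup_set0; exact: filter_not_empty.
  split; first exact: Fn.
    move=> S S' GS GS'; rewrite -bigcap2E; apply: GI => k _.
    by case: k => [|[|k]] //=; exact: Fn.
  by move=> S S' SS'; apply: (@filterS _ F); exact: bigcup_subset.
have G_ultra : UltraFilter G.
  apply: ultra_of_decides => // S.
  have [|FS|FnS] := F_decides (\bigcup_(i in S) E n i); [|by left|right].
    by apply: bigcup_open => i _.
  apply: filterS (filterI Fn FnS) => x [[i _ Ei] nEx]; exists i => // Si.
  by apply: nEx; exists i.
apply: (@exists_measurable_cardinal X G) => //.
move=> /ultra_principalP[x]; rewrite /G /= bigcup_set1 => FE.
have [_ FU] := UP x.
by have [y [/EU]] := filter_ex (filterI FE FU).
Qed.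

End metric.

(** * The five properties and discrete spaces *)

(** In any space, open sets are G_delta and Borel and closed sets are F_sigma, so [A] or its
    complement has the property. *)
Lemma ultrafilter_of_decides_open {c : set_class} {X : topologicalType}
    {F : set_system X} : is_ultrafilter_of (sets_of c X) F ->
  forall A, open A -> F A \/ F (~` A).
Proof.
move=> [_ F_decides] A A_open.
case: c F_decides => /= F_decides; [exact: F_decides| | | |].
- have [|FnA|] := F_decides (~` A); [exact: open_closedC|by right|].
  by rewrite setCK; left.
- exact/F_decides/open_Gdelta.
- have [|FnA|] := F_decides (~` A); [|by right|by rewrite setCK; left].
  exact/closed_Fsigma/open_closedC.
- by apply: F_decides; exact: sub_sigma_algebra.
Qed.

Lemma sets_of_discrete (c : set_class) (X : discreteTopologicalType) :
  sets_of c X = setT.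
Proof.
apply/seteqP; split=> // A _; case: c => /=.
- exact: discrete_open.
- exact: discrete_closed.
- exact/open_Gdelta/discrete_open.
- by apply: closed_Fsigma; exact: discrete_closed.
- by apply: sub_sigma_algebra; exact: discrete_open.
Qed.

Lemma discrete_metrizable (R : realType) (X : discreteTopologicalType) :
  metrizable R X.
Proof.
exists (fun x y => (x != y)%:R%R); last first.
  move=> A; split=> [_ x Ax|_]; last exact: discrete_open.
  exists 1%R => // y /=; case: eqVneq => [<- //|_].
  by rewrite ltxx.
split=> [x y|x y|x y z].
- split=> [/eqP|->]; last by rewrite eqxx.
  by rewrite pnatr_eq0 eqb0 negbK => /eqP.
- by rewrite eq_sym.
- rewrite -natrD ler_nat; case: (eqVneq x y) => [->//|_].
  by case: (x != z).
Qed.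

Lemma complete_omega1 (K : Type) (F : set_system K) :
  ~~ countable [set: K] -> complete_filter K F -> omega1_complete F.
Proof.
move=> K_uncountable F_complete D G FG.
(* The family is reindexed along a section [h] of a surjection [s] from [K] to [nat]; its index set
   is countable, hence smaller than [K]. *)
have /infiniteP/pcard_surjP[s s_surj] : infinite_set [set: K].
  by move=> /finite_set_countable; exact/negP.
have /choice[h hs] n : exists k, s k = n.
  by have [k _ <-] := s_surj n Logic.I; exists k.
have -> : \bigcap_(n in D) G n = \bigcap_(k in h @` D) G (s k).
  by rewrite bigcap_image; under [RHS]eq_bigcapr do rewrite hs.
apply: F_complete => [|_ [n Dn <-]]; last by rewrite hs; exact: FG.
apply: contra K_uncountable => /sub_countable; apply.
by apply: sub_countable (card_image_le _ _) _; exact: countableP.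
Qed.

Theorem theorem2p5 (R : realType) (c : set_class) :
  (exists X : topologicalType,
    [/\ hausdorff_space X, infinite_set [set: X], metrizable R X &
      exists F : set_system X,
        [/\ is_ultrafilter_of (sets_of c X) F, free_filter F &
          omega1_complete F]])
  <-> (exists K : Type, measurable_cardinal K).
Proof.
split=> [[X [_ _ [d d_metric d_open] [F [F_ultra F_free F_omega1]]]]|].
  apply: (metric_measurable_cardinal d_metric d_open F) => //.
    by have [[]] := F_ultra.
  exact: ultrafilter_of_decides_open F_ultra.
move=> [K [K_uncountable [F [F_ultra F_nonprincipal F_complete]]]].
exists (discrete_topology {classic K}); split.
- exact: discrete_hausdorff.
- by move=> /finite_set_countable; exact/negP.
- exact: discrete_metrizable.
exists F; split; last exact: complete_omega1.
(* All subsets have the property here, so [F] serves as its own base. *)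
- rewrite sets_of_discrete; split=> [|A _]; last exact: in_ultra_setVsetC.
  split; first exact: ultra_proper.
  by exists F => //; apply/seteqP; split=> [A FA|A [B FB /filterS]];
    [exists A|exact].
- move=> x; exists [set x].
    by split=> //; exact: discrete_open.
  have [Fx|//] := in_ultra_setVsetC [set x] F_ultra.
  by case: F_nonprincipal; apply/ultra_principalP; exists x.
Qed.
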